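(* Let $p$ be a prime, $m$ a positive integer, $q=p^m$ with $q>2$, and $n=q^2+1$. Let $\lambda\in\mathbb{F}_{q^2}^*$ have multiplicative order $r$, where $r\mid(q-1)$ and $\nu_2(r)=\nu_2(q-1)$. Let $\delta\in\mathbb{F}_{q^4}$ be a primitive $rn$-th root of unity with $\delta^n=\lambda$. Let $g_1(x)=(x-\delta)(x-\delta^{q^2})$ and $g_{q^2-q+1}(x)=(x-\delta^{q^2-q+1})(x-\delta^{q^4-q^3+q^2})$, and let $\mathcal{C}(1,q^2-q+1)$ be the $\lambda$-constacyclic code of length $n$ over $\mathbb{F}_{q^2}$ with check polynomial $g_1(x)g_{q^2-q+1}(x)$. Then $\mathcal{C}(1,q^2-q+1)$ has parameters $[q^2+1,4,q^2-q]$ and weight enumerator \[ 1+(q^5-q)z^{q^2-q}+\frac{(q^4-1)(q-1)q^3}{2}\left(z^{q^2-1}+z^{q^2+1}\right)+(q^7-q^5+q^4-q^3+q-1)z^{q^2}. \] Furthermore, the supports of the minimum weight codewords of $\mathcal{C}(1,q^2-q+1)$ form a $3$-$(q^2+1,q^2-q,(q^2-q-1)(q-2))$ design. The dual code $\mathcal{C}(1,q^2-q+1)^\perp$ has parameters $[q^2+1,q^2-3,4]$, and the supports of its minimum weight codewords form a $3$-$(q^2+1,4,q-2)$ design.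
   Context: $\nu_2$ is the $2$-adic valuation. A $\lambda$-constacyclic code of length $n$ over $\mathbb{F}_{q^2}$ is an ideal of $\mathbb{F}_{q^2}[x]/\langle x^n-\lambda\rangle$; its check polynomial is $(x^n-\lambda)/g(x)$ where $g$ is the monic generator polynomial. The weight enumerator is $\sum_iA_iz^i$ with $A_i$ the number of codewords of weight $i$. A $t$-$(v,\kappa,\eta)$ design is a set of $\kappa$-subsets (blocks) of a $v$-set such that every $t$-subset lies in exactly $\eta$ blocks; here points are coordinate positions and blocks are the distinct supports of codewords of the given weight. *)

(* Defs.v *)
From HB Require Import structures.
From mathcomp Require Import all_boot all_order all_algebra.
Set Implicit Arguments. Unset Strict Implicit. Unset Printing Implicit Defensive.
Import GRing.Theory.
Local Open Scope ring_scope.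

Definition supp (F : fieldType) (n : nat) (c : 'rV[F]_n) : {set 'I_n} :=
  [set i : 'I_n | c 0 i != 0].
Definition wt (F : fieldType) (n : nat) (c : 'rV[F]_n) : nat := #|supp c|.

Definition weight_count (F : finFieldType) (n : nat) (C : {set 'rV[F]_n}) (i : nat) : nat :=
  #|[set c in C | wt c == i]|.

Definition code_dim (F : finFieldType) (n : nat) (C : {set 'rV[F]_n}) : nat :=
  \dim (<<enum C>>%VS : {vspace 'rV[F]_n}).

Definition min_distance (F : finFieldType) (n : nat) (C : {set 'rV[F]_n}) (d : nat) : Prop :=
  (exists2 c, c \in C & (c != 0) && (wt c == d)) /\
  (forall c, c \in C -> c != 0 -> (d <= wt c)%N).

Definition dual_code (F : finFieldType) (n : nat) (C : {set 'rV[F]_n}) : {set 'rV[F]_n} :=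
  [set x : 'rV[F]_n | [forall c in C, \sum_(i < n) x 0 i * c 0 i == 0]].

Definition weight_supports (F : finFieldType) (n : nat) (C : {set 'rV[F]_n}) (k : nat)
  : {set {set 'I_n}} := [set supp c | c in C & wt c == k].

Definition is_design (t v k eta : nat) (B : {set {set 'I_v}}) : Prop :=
  (forall b, b \in B -> #|b| = k) /\
  (forall T : {set 'I_v}, #|T| = t -> #|[set b in B | T \subset b]| = eta).

(* lambda-constacyclic code of length n over F with check polynomial h (h has
   its roots in the extension L, sigma : F -> L is the embedding).  The code is
   the ideal of F[x]/<x^n - lambda> generated by g = (x^n - lambda)/h, i.e. the
   vectors whose polynomial (of degree < n) is divisible by g. *)
Definition constacyclic_code (F L : finFieldType) (sigma : {rmorphism F -> L})
  (n : nat) (lam : F) (h : {poly L}) : {set 'rV[F]_n} :=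
  [set c : 'rV[F]_n |
     (('X^n - (sigma lam)%:P) %/ h) %| map_poly sigma (rVpoly c)].

(* Main.v *)
(* A codeword is c_i = sum_k u_k y_i^(q^k) with y_i = delta^(n-1-i), and with
   t_i = y_i^(q-1), an n-th root of unity, c_i / y_i = u_0 + u_1 t_i
   + u_2 t_i^(q+1) + u_3 t_i^q.  Hence a nonzero word has at most q+1 zeros.
   This form is bilinear in (1, t) and (1, t^q), so if it vanishes at three of
   the t_i it vanishes on the image of PG(1,q) under the Moebius map sending
   0, 1, infinity to them, and these q+1 points are again n-th roots of unity.
   Products (t - t_a)(t^q - t_b^q) show that any three columns of a generator
   matrix are independent.  So the number of words vanishing on a given set of
   at most 3 positions is known; since a nonzero word has 0, 1, 2 or q+1 zeros,
   these counts determine the weight enumerator, and the zero sets of size q+1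
   form a 3-(q^2+1, q+1, 1) design.  Supports of minimum weight words are the
   complements of its blocks, and supports of minimum weight dual words are the
   4-subsets of its blocks. *)
Require Import Defs.
From HB Require Import structures.
From mathcomp Require Import all_boot all_order all_algebra.
From mathcomp Require Import fingroup mxabelem finfield zify ring.
Import GRing.Theory.
Local Open Scope ring_scope.

(** * Codes given by a generator matrix *)

Section RowCode.
Set Implicit Arguments.
Unset Strict Implicit.
Variable F : finFieldType.

(** Coordinates in a basis of the row space map injectively and linearly onto [C], so the span of
    the codewords is the image of that map. *)
Lemma code_dim_rowspace (m n : nat) (A : 'M[F]_(m, n)) (C : {set 'rV[F]_n}) :
  (forall v, (v \in C) = (v <= A)%MS) -> code_dim C = \rank A.
Proof.
move=> CE; pose f : 'Hom('rV[F]_(\rank A), 'rV[F]_n) := linfun (mulmxr (row_base A)).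
have kf : lker f == 0%VS.
  apply/lker0P => u v; rewrite !lfunE /= => e.
  exact: (row_free_inj (row_base_free A)) e.
rewrite /code_dim (_ : <<enum C>>%VS = limg f).
  by rewrite limg_dim_eq ?(eqP kf) ?capv0 // dimvf /dim /= mul1n.
apply/eqP; rewrite eqEsubv; apply/andP; split.
  apply/span_subvP => v; rewrite mem_enum CE -(eq_row_base A) => /submxP[w ->].
  by apply/memv_imgP; exists w; rewrite ?memvf // lfunE.
apply/subvP => v /memv_imgP[w _ ->]; rewrite lfunE /=.
by apply: memv_span; rewrite mem_enum CE -(eq_row_base A) submxMl.
Qed.

Lemma wt0 n : wt (0 : 'rV[F]_n) = 0%N.
Proof. by apply/eqP; rewrite cards_eq0; apply/eqP/setP => i; rewrite !inE mxE eqxx. Qed.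

Variables (k n : nat) (G : 'M[F]_(k, n)).

Definition zeros (w : 'rV[F]_k) : {set 'I_n} := ~: supp (w *m G).

Definition row_code : {set 'rV[F]_n} := [set w *m G | w : 'rV[F]_k].

Lemma mem_row_code w : w *m G \in row_code.
Proof. exact: imset_f. Qed.

(** With this encoding [A *m (select J)^T] keeps the columns of [A] in [J], while [v *m select J]
    extends [v] by zero outside [J]. *)
Definition select (J : {set 'I_n}) : 'M[F]_(#|J|, n) := rowsub enum_val 1%:M.

Lemma mulmx_select m (A : 'M[F]_(m, n)) (J : {set 'I_n}) i j :
  (A *m (select J)^T) i j = A i (enum_val j).
Proof.
rewrite mxE (bigD1 (enum_val j)) //= !mxE eqxx mulr1 big1 ?addr0 // => l ln.
by rewrite !mxE eq_sym (negPf ln) mulr0.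
Qed.

Lemma mem_zeros w i : (i \in zeros w) = ((w *m G) 0 i == 0).
Proof. by rewrite !inE negbK. Qed.

Lemma zeros_kermx w (J : {set 'I_n}) :
  (J \subset zeros w) = (w <= kermx (G *m (select J)^T))%MS.
Proof.
apply/subsetP/sub_kermxP => [H | H i iJ].
  apply/rowP => j; rewrite mulmxA mulmx_select [RHS]mxE.
  by apply/eqP; rewrite -mem_zeros; apply/H/enum_valP.
rewrite mem_zeros -(enum_rankK_in iJ iJ) -mulmx_select -mulmxA H.
by rewrite mxE.
Qed.

(** The messages vanishing on [J] form the left kernel of the column submatrix at [J], so
    rank-nullity applies. *)
Lemma card_vanishing (J : {set 'I_n}) :
  #|[set w | J \subset zeros w]|
    = (#|F| ^ (k - \rank (G *m (select J)^T)))%N.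
Proof.
rewrite -mxrank_ker -card_rowg; apply: eq_card => w.
by rewrite mem_rowg inE zeros_kermx.
Qed.

Lemma code_dim_row_code : row_free G -> code_dim row_code = k.
Proof.
move=> /eqP <-; apply: code_dim_rowspace => v.
apply/imsetP/submxP => [[w _ ->]|[w ->]]; by exists w.
Qed.

Lemma mem_dual_row_code x : (x \in dual_code row_code) = (x *m G^T == 0).
Proof.
rewrite inE; apply/forallP/eqP => [H|H c].
  apply/rowP => i; have := H (row i G).
  rewrite rowE mem_row_code => /= /eqP; rewrite -rowE => e; rewrite [RHS]mxE -[RHS]e mxE.
  by apply: eq_bigr => j _; rewrite !mxE.
apply/implyP => /imsetP[w _ ->].
have -> : \sum_(i < n) x 0 i * (w *m G) 0 i = (x *m (w *m G)^T) 0 0.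
  by rewrite mxE; apply: eq_bigr => j _; rewrite [in RHS]mxE.
by rewrite trmx_mul mulmxA H mul0mx mxE.
Qed.

Lemma code_dim_dual_row_code : row_free G ->
  code_dim (dual_code row_code) = (n - k)%N.
Proof.
move=> /eqP rG; rewrite (@code_dim_rowspace _ _ (kermx G^T)).
  by rewrite mxrank_ker mxrank_tr rG.
by move=> v; rewrite mem_dual_row_code sub_kermx.
Qed.

(** A linear relation between the columns in [J], extended by zero, is a dual word. *)
Lemma dual_word_on (J : {set 'I_n}) : (\rank (G *m (select J)^T) < #|J|)%N ->
  exists x, [/\ x \in dual_code row_code, x != 0 & supp x \subset J].
Proof.
move=> rJ; have : kermx (G *m (select J)^T)^T != 0.
  by rewrite -mxrank_eq0 mxrank_ker mxrank_tr -lt0n subn_gt0.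
case/rowV0Pn => v /sub_kermxP vK v0.
exists (v *m select J); rewrite mem_dual_row_code; split.
- by rewrite -mulmxA -[_ *m G^T]trmxK trmx_mul trmxK vK.
- apply: contraNneq v0 => e; apply/eqP/rowP => j.

  have := congr1 (fun M : 'rV_n => M 0 (enum_val j)) e; rewrite !mxE.
  rewrite (bigD1 j) //= !mxE eqxx mulr1 big1 ?addr0 // => l ln.
  by rewrite !mxE (inj_eq enum_val_inj) (negPf ln) mulr0.
- apply/subsetP => j; rewrite inE; apply: contraR => jJ.
  rewrite mxE big1 // => l _; rewrite !mxE.
  case: eqP => [e|]; last by rewrite mulr0.
  by rewrite -e enum_valP in jJ.
Qed.

Lemma rank_select (J : {set 'I_n}) :
  (forall x, x \in dual_code row_code -> supp x \subset J -> x = 0) ->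
  \rank (G *m (select J)^T) = #|J|.
Proof.
move=> H; apply/eqP; rewrite eqn_leq rank_leq_col leqNgt.
apply/negP => /dual_word_on[x [xD x0 xJ]].
by rewrite (H x) ?eqxx in x0.
Qed.

End RowCode.

(** * Double counting *)

Section DoubleCounting.
Set Implicit Arguments.
Unset Strict Implicit.

(** Removing [J] turns these sets into the subsets of [B :\: J] with [t - #|J|] elements. *)
Lemma card_between (T : finType) (J B : {set T}) (t : nat) :
  J \subset B -> (#|J| <= t)%N ->
  #|[set S : {set T} | [&& J \subset S, S \subset B & #|S| == t]]|
    = 'C(#|B| - #|J|, t - #|J|).
Proof.
move=> JB Jt; rewrite -(cardsDS JB) -cards_draws.
transitivity #|[set J :|: A | A in
    [set A : {set T} | A \subset B :\: J & #|A| == (t - #|J|)%N]]|.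
  apply: eq_card => S; apply/idP/imsetP => [|[A + ->]].
    rewrite inE => /and3P[JS SB /eqP cS]; exists (S :\: J).
      by rewrite inE setSD //= cardsDS // cS.
    by rewrite setDE setUIr setUCr setIT; apply/esym/setUidPr.
  rewrite !inE subsetUl subUset JB subsetD => /andP[/andP[-> dA] /eqP cA] /=.
  by rewrite cardsU (setIC J) (disjoint_setI0 dA) cards0 subn0 cA subnKC.
apply: card_in_imset => A A'.
rewrite !inE !subsetD => /andP[/andP[_ d] _] /andP[/andP[_ d'] _] e.
have aux (X : {set T}) : [disjoint X & J] -> (J :|: X) :\: J = X.
  by move=> dX; rewrite setDUl setDv set0U; apply/setDidPl.
by rewrite -(aux A) // e aux.
Qed.

(** Pairs [(w, S)] with [J \subset S], [S \subset Z w] and [#|S| = t] are counted in two ways.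
    Taking zero sets for [Z] yields moment equations; taking [id] yields block counts of a
    design. *)
Lemma sum_bin_subsets (I T : finType) (P : pred I) (Z : I -> {set T})
    (J : {set T}) (t c : nat) : (#|J| <= t)%N ->
  (forall S : {set T}, J \subset S -> #|S| = t ->
     #|[set w | P w & S \subset Z w]| = c) ->
  (\sum_(w | P w && (J \subset Z w)) 'C(#|Z w| - #|J|, t - #|J|)
    = 'C(#|T| - #|J|, t - #|J|) * c)%N.
Proof.
move=> Jt Hc.
transitivity (\sum_(w | P w && (J \subset Z w))
   \sum_(S : {set T} | [&& J \subset S, #|S| == t & S \subset Z w]) 1)%N.
  apply: eq_bigr => w /andP[_ JZ]; rewrite sum1dep_card -card_between //.
  by apply: eq_card => S; rewrite !inE [(_ == t) && _]andbC.
rewrite (exchange_big_dep (fun S : {set T} => (J \subset S) && (#|S| == t))) /=.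
  rewrite (eq_bigr (fun _ => c)) => [|S /andP[JS /eqP cS]].
    rewrite sum_nat_const -cardsT -card_between ?subsetT ?cardsT //.
    congr (_ * _)%N; apply: eq_card => S.
    by rewrite unfold_in /= inE subsetT.
  rewrite sum1dep_card -(Hc S) //; apply: eq_card => w; rewrite !inE JS cS eqxx.
  case SZ : (S \subset Z w); last by rewrite !andbF.
  by rewrite (subset_trans JS SZ) !andbT.
by move=> w S _ /and3P[-> -> _].
Qed.

Lemma design_count (t v k eta : nat) (B : {set {set 'I_v}}) (J : {set 'I_v}) :
  is_design t k eta B -> (#|J| <= t)%N ->
  (#|[set b in B | J \subset b]| * 'C(k - #|J|, t - #|J|)
    = 'C(v - #|J|, t - #|J|) * eta)%N.
Proof.
move=> [Bk Beta] Jt.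
have := @sum_bin_subsets _ _ (mem B) id J t eta Jt.
rewrite card_ord => <- => [|S _ /Beta //].
rewrite (eq_bigr (fun _ => 'C(k - #|J|, t - #|J|))).
  by rewrite sum_nat_cond_const; congr (_ * _)%N; apply: eq_card => b; rewrite inE.
by move=> b /andP[/Bk -> _].
Qed.

(** One step of inclusion-exclusion: blocks are sorted by whether they contain [x]. *)
Lemma card_avoid_split (T : finType) (B : {set {set T}}) (K J : {set T}) (x : T) :
  (#|[set b in B | (K \subset b) && [disjoint (x |: J) & b]]|
   + #|[set b in B | (x |: K \subset b) && [disjoint J & b]]|
   = #|[set b in B | (K \subset b) && [disjoint J & b]]|)%N.
Proof.
rewrite -[RHS](cardsID [set b : {set T} | x \in b]) addnC; congr (_ + _)%N.
  apply: eq_card => b; rewrite !inE subUset sub1set.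
  by case: (x \in b); rewrite ?andbF ?andbT.
apply: eq_card => b; rewrite !inE !disjoints_subset subUset sub1set !inE.
by case: (x \in b); rewrite ?andbF ?andbT.
Qed.

End DoubleCounting.

(** * Codes of dimension 4 whose words have 0, 1, 2 or q+1 zeros *)

Section OvoidCode.
Set Implicit Arguments.
Unset Strict Implicit.
Variables (F : finFieldType) (q n : nat) (G : 'M[F]_(4, n)).
Hypothesis q_gt2 : (2 < q)%N.
Hypothesis nE : n = (q ^ 2 + 1)%N.
Hypothesis cardF : #|F| = (q ^ 2)%N.
Hypothesis zerosP : forall w : 'rV_4, w != 0 ->
  (#|zeros G w| <= 2)%N \/ #|zeros G w| = q.+1.
Hypothesis dualP : forall x : 'rV_n,
  x \in dual_code (row_code G) -> (wt x <= 3)%N -> x = 0.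

(** A nonzero message in the left kernel would have [q ^ 2 + 1] zeros, a number that [zerosP]
    excludes. *)
Lemma ovoid_row_free : row_free G.
Proof.
apply: contraT => rG.
have : kermx G != 0 by rewrite kermx_eq0.
case/rowV0Pn => w /sub_kermxP wG w0.
have Zw : #|zeros G w| = n.
  rewrite -[RHS]card_ord -cardsT; congr #|pred_of_set _|; apply/setP => i.
  by rewrite mem_zeros wG mxE eqxx inE.
by case: (zerosP w0); rewrite Zw nE; nia.
Qed.

(** The hypothesis [dualP] means that any three columns of [G] are independent. *)
Lemma ovoid_rank (J : {set 'I_n}) : (#|J| <= 3)%N ->
  \rank (G *m (select F J)^T) = #|J|.
Proof.
move=> J3; apply: rank_select => x xD xJ; apply: dualP => //.
exact: leq_trans (subset_leq_card xJ) J3.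
Qed.

Lemma card_vanishing_ovoid (J : {set 'I_n}) : (#|J| <= 3)%N ->
  #|[set w | J \subset zeros G w]| = ((q ^ 2) ^ (4 - #|J|))%N.
Proof. by move=> J3; rewrite card_vanishing ovoid_rank // cardF. Qed.

Lemma card_vanishing_nz (J : {set 'I_n}) : (#|J| <= 3)%N ->
  #|[set w | (w != 0) && (J \subset zeros G w)]| = ((q ^ 2) ^ (4 - #|J|) - 1)%N.
Proof.
move=> J3; rewrite -(card_vanishing_ovoid J3) [in RHS](cardsD1 0).
have -> : (0 \in [set w | J \subset zeros G w]).
  by rewrite inE; apply/subsetP => i _; rewrite mem_zeros mul0mx mxE.
by rewrite add1n subn1 /=; apply: eq_card => w; rewrite !inE.
Qed.

(** * Numbers of zeros and the weight enumerator *)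

Definition nb_zeros (i : nat) := #|[set w : 'rV_4 | (w != 0) && (#|zeros G w| == i)]|.

Lemma sum_by_zeros (f : nat -> nat) :
  (\sum_(w : 'rV[F]_4 | w != 0%R) f #|zeros G w| =
   nb_zeros 0 * f 0 + nb_zeros 1 * f 1 + nb_zeros 2 * f 2
   + nb_zeros q.+1 * f q.+1)%N.
Proof.
pose s := [:: 0%N; 1%N; 2%N; q.+1].
transitivity (\sum_(w : 'rV[F]_4 | w != 0%R)
   \sum_(i <- s) (#|zeros G w| == i) * f i)%N.
  apply: eq_bigr => w w0; rewrite !big_cons big_nil.
  case: (zerosP w0) => [|->].
    by move: #|_| => [|[|[|//]]] _ /=; rewrite ?mul1n ?mul0n ?addn0 //;
      case: eqP => [|_]; try lia; rewrite ?mul0n ?add0n ?addn0.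
  have [h0 h1 h2] : [/\ 0 < q.+1, 1 < q.+1 & 2 < q.+1]%N by split; lia.
  by rewrite (gtn_eqF h0) (gtn_eqF h1) (gtn_eqF h2) eqxx !mul0n mul1n addn0.
rewrite exchange_big /= !big_cons big_nil /= addn0 !addnA.
have E i : (\sum_(w : 'rV[F]_4 | w != 0%R) (#|zeros G w| == i) * f i
           = nb_zeros i * f i)%N.
  by rewrite -big_distrl -big_mkcondr /= sum1dep_card.
by rewrite !E.
Qed.

(** Binomial moments: pairs of a nonzero message and a [t]-subset of its zeros are counted from both
    sides. *)
Lemma moments (t : nat) : (t <= 3)%N ->
  (nb_zeros 0 * 'C(0, t) + nb_zeros 1 * 'C(1, t) + nb_zeros 2 * 'C(2, t)
   + nb_zeros q.+1 * 'C(q.+1, t) = 'C(n, t) * ((q ^ 2) ^ (4 - t) - 1))%N.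
Proof.
move=> t3; rewrite -(sum_by_zeros (fun k => 'C(k, t))).
have := @sum_bin_subsets _ _ (fun w : 'rV[F]_4 => w != 0) (zeros G) set0 t
  ((q ^ 2) ^ (4 - t) - 1).
rewrite cards0 !subn0 card_ord => <- //.
  by apply: eq_big => [w|w _]; rewrite ?sub0set ?andbT ?subn0.
by move=> S _ St; rewrite card_vanishing_nz St.
Qed.

(** The four moments form a triangular system: [t = 3] involves only [nb_zeros q.+1], and each
    smaller [t] brings in one new unknown. *)
Lemma nb_zeros_values :
  [/\ nb_zeros q.+1 = (q ^ 5 - q)%N,
      nb_zeros 2 = ((q ^ 4 - 1) * (q - 1) * q ^ 3 %/ 2)%N,
      nb_zeros 1 = (q ^ 7 - q ^ 5 + q ^ 4 - q ^ 3 + q - 1)%N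
    & nb_zeros 0 = ((q ^ 4 - 1) * (q - 1) * q ^ 3 %/ 2)%N].
Proof.
(* Writing [q] as [s.+3] removes the truncated subtractions, so that [ring] and [lia] apply. *)
have [s qs] : exists s, q = s.+3 by exists (q - 3)%N; lia.
have subE a b c : a = (b + c)%N -> (a - c = b)%N by move=> ->; rewrite addnK.
have := @moments 0 isT; have := @moments 1 isT; have := @moments 2 isT.
(* The factor 6 clears the denominator of ['C(_, 3)]; a factor 2 does the same below for
   ['C(_, 2)]. *)
have := congr1 (muln 6) (@moments 3 isT).
rewrite !bin0 !bin1 !bin0n /= ?(@bin_small 1) // ?(@bin_small 2 3) // ?binn.
rewrite !muln0 !add0n !muln1 !subn0 mul1n.
have b3 m : (6 * 'C(m.+2, 3) = m.+2 * m.+1 * m)%N.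
  by rewrite -[6%N]/(3`!) mulnC bin_ffact !ffactnS ffactn0 muln1 /= mulnA.
have b2 m : (2 * 'C(m.+1, 2) = m.+1 * m)%N.
  by rewrite -[2%N]/(2`!) mulnC bin_ffact !ffactnS ffactn0 muln1.
have q1 : (q - 1 = s.+2)%N by rewrite qs subn1.
have q2 : (q ^ 2 - 1 = s.+2 * s.+4)%N by apply: subE; rewrite qs; ring.
have q4 : (q ^ 4 - 1 = s.+2 * s.+4 * (q ^ 2 + 1))%N.
  by apply: subE; rewrite qs; ring.
have q22 : ((q ^ 2) ^ 2 - 1 = s.+2 * s.+4 * (q ^ 2 + 1))%N.
  by apply: subE; rewrite qs; ring.
have q23 : ((q ^ 2) ^ 3 - 1 = s.+2 * s.+4 * (q ^ 4 + q ^ 2 + 1))%N.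
  by apply: subE; rewrite qs; ring.
have q24 : ((q ^ 2) ^ 4 - 1 = s.+2 * s.+4 * (q ^ 2 + 1) * (q ^ 4 + 1))%N.
  by apply: subE; rewrite qs; ring.
have q5 : (q ^ 5 - q = q * s.+2 * s.+4 * (q ^ 2 + 1))%N.
  by apply: subE; rewrite qs; ring.
have q7 : (q ^ 7 - q ^ 5 + q ^ 4 - q ^ 3 + q - 1
    = q ^ 5 * s.+2 * s.+4 + q ^ 3 * s.+2 + s.+2)%N.
  have -> : (q ^ 7 - q ^ 5 = q ^ 5 * s.+2 * s.+4)%N.
    by apply: subE; rewrite qs; ring.
  have -> : (q ^ 5 * s.+2 * s.+4 + q ^ 4 - q ^ 3
      = q ^ 5 * s.+2 * s.+4 + q ^ 3 * s.+2)%N by apply: subE; rewrite qs; ring.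
  by apply: subE; rewrite qs; ring.
rewrite nE -[(4 - 3)%N]/1%N -[(4 - 2)%N]/2%N -[(4 - 1)%N]/3%N expn1.
rewrite q1 q2 q4 q5 q7 q22 q23 q24 => E3 /(congr1 (muln 2)) E2 E1 E0.
have {}E3 : (nb_zeros q.+1 * (s.+4 * q * s.+2)
    = (q ^ 2 + 1) * q ^ 2 * (s.+2 * s.+4) * (s.+2 * s.+4))%N.
  move: E3; rewrite mulnCA [RHS]mulnA.
  (* As [q ^ 2 - 1 = s.+2 * s.+4], this puts [n] in the double successor form that [b3] expects. *)
  have -> : (q ^ 2 + 1 = (s.+2 * s.+4).+2)%N by rewrite qs; ring.
  rewrite !b3 !qs b3 => ->; ring.
have {}E2 : (2 * nb_zeros 2 + nb_zeros q.+1 * (q.+1 * q)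
    = (q ^ 2 + 1) * q ^ 2 * (s.+2 * s.+4 * (q ^ 2 + 1)))%N.
  by move: E2; rewrite mulnDr mulnCA b2 => ->; rewrite mulnA addn1 b2.
have N3 : nb_zeros q.+1 = (q * s.+2 * s.+4 * (q ^ 2 + 1))%N.
  apply/eqP; have X0 : (0 < s.+4 * q * s.+2)%N by rewrite qs.
  by rewrite -(eqn_pmul2r X0) E3; apply/eqP; ring.
have N2 : (2 * nb_zeros 2 = s.+2 * s.+4 * (q ^ 2 + 1) * s.+2 * q ^ 3)%N.
  by move: E2; rewrite N3 qs; lia.
have N1 : nb_zeros 1 = (q ^ 5 * s.+2 * s.+4 + q ^ 3 * s.+2 + s.+2)%N.
  by move: E1; rewrite [(nb_zeros 2 * 2)%N]mulnC N2 N3 qs; lia.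
(* [N2] shows that the numerator is twice [nb_zeros 2], so the truncating division by 2 is exact. *)
rewrite -N2 mulKn //; split=> //.
by move: E0 N2; rewrite N1 N3 qs; lia.
Qed.

Lemma wt_zeros (w : 'rV[F]_4) : (wt (w *m G) + #|zeros G w|)%N = n.
Proof. by rewrite /wt /zeros cardsC card_ord. Qed.

Lemma zeros_le (w : 'rV[F]_4) : w != 0 -> (#|zeros G w| <= q.+1)%N.
Proof. by case/zerosP => [|->]; lia. Qed.

Lemma mulG_eq0 (w : 'rV[F]_4) : (w *m G == 0) = (w == 0).
Proof.
by rewrite -(inj_eq (row_free_inj ovoid_row_free) w) mul0mx.
Qed.

(** Encoding is injective and [z] zeros mean weight [n - z], so the four zero numbers become the
    four nonzero weights. The zero message is counted apart. *)
Lemma weight_count_ovoid i : weight_count (row_code G) i =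
  if i == 0%N then 1%N
  else if i == (q ^ 2 - q)%N then (q ^ 5 - q)%N
  else if (i == (q ^ 2 - 1)%N) || (i == (q ^ 2 + 1)%N)
    then ((q ^ 4 - 1) * (q - 1) * q ^ 3 %/ 2)%N
  else if i == (q ^ 2)%N then (q ^ 7 - q ^ 5 + q ^ 4 - q ^ 3 + q - 1)%N
  else 0%N.
Proof.
have -> : weight_count (row_code G) i =
    ((0 == i) + \sum_(w : 'rV[F]_4 | w != 0%R) ((n - #|zeros G w|)%N == i))%N.
  transitivity (\sum_(w : 'rV[F]_4) (wt (w *m G) == i))%N.
    rewrite -big_mkcond sum1dep_card /weight_count.
    rewrite -(card_imset _ (row_free_inj ovoid_row_free)).
    apply: eq_card => c; rewrite inE; apply/andP/imsetP.
      by case=> /imsetP[w _ ->] cw; exists w; rewrite ?inE.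
    by case=> w; rewrite inE => cw ->; split=> //; apply: mem_row_code.
  rewrite (bigD1 0) //=; congr (_ + _)%N.
    by rewrite mul0mx wt0.
  by apply: eq_bigr => w _; rewrite -[X in (X - _)%N](wt_zeros w) addnK.
rewrite (sum_by_zeros (fun k => (n - k)%N == i)).
have [-> -> -> ->] := nb_zeros_values.
move: ((q ^ 4 - 1) * (q - 1) * q ^ 3 %/ 2)%N => a.
move: (q ^ 7 - _ + _ - _ + _ - _)%N (q ^ 5 - q)%N => b c.
(* This bound keeps the weights distinct and nonzero after [q ^ 2] is abstracted to [Q]. *)
have q_sq : (3 * q <= q ^ 2)%N by nia.
rewrite nE; move: (q ^ 2)%N q_sq => Q qQ.
rewrite subn0 addnK addn1 !subSS.
by do ![case: eqP => /= ?]; lia.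
Qed.

Lemma min_distance_ovoid : min_distance (row_code G) (q ^ 2 - q).
Proof.
have q_sq : (q <= q ^ 2)%N by nia.
split.
  have : (0 < nb_zeros q.+1)%N.
    have [-> _ _ _] := nb_zeros_values.
    by rewrite subn_gt0 -[X in (X < _)%N]expn1 ltn_exp2l //; lia.
  rewrite card_gt0 => /set0Pn[w]; rewrite inE => /andP[w0 /eqP Zw].
  exists (w *m G); first exact: mem_row_code.
  rewrite mulG_eq0 w0 /=; apply/eqP; have := wt_zeros w.
  by rewrite Zw; move: (wt _) => W; rewrite nE; lia.
move=> c /imsetP[w _ ->]; rewrite mulG_eq0 => /zeros_le Zw.
by have := wt_zeros w; move: (wt _) #|_| Zw => W Z; rewrite nE; lia.
Qed.

(** * The inversive plane of circles *)

Definition circles : {set {set 'I_n}} :=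
  [set zeros G w | w in [set w : 'rV_4 | (w != 0) && (#|zeros G w| == q.+1)]].

(** Exactly [q ^ 2 = #|F|] messages vanish on [T], and the multiples of [w] already supply that
    many. *)
Lemma vanishing3_prop (T : {set 'I_n}) (w w' : 'rV[F]_4) : #|T| = 3%N -> w != 0 ->
  T \subset zeros G w -> T \subset zeros G w' -> exists a, w' = a *: w.
Proof.
move=> T3 w0 Tw Tw'.
have sub : [set a *: w | a in F] \subset [set w | T \subset zeros G w].
  apply/subsetP => _ /imsetP[a _ ->]; rewrite inE; apply/subsetP => i iT.
  have := subsetP Tw i iT; rewrite !mem_zeros => /eqP wi0.
  by rewrite -scalemxAl mxE wi0 mulr0.
have inj : injective (fun a => a *: w).
  move=> a b /eqP; rewrite -subr_eq0 -scalerBl scaler_eq0 (negPf w0) orbF.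
  by rewrite subr_eq0 => /eqP.
have : w' \in [set a *: w | a in F].
  suff -> : [set a *: w | a in F] = [set w | T \subset zeros G w] by rewrite inE.
  apply/eqP; rewrite eqEcard sub card_vanishing_ovoid T3 // card_imset //.
  by rewrite cardF -[(4 - 3)%N]/1%N expn1 leqnn.
by case/imsetP => a _ ->; exists a.
Qed.

Lemma zeros_scale a (w : 'rV[F]_4) : a != 0 -> zeros G (a *: w) = zeros G w.
Proof.
by move=> a0; apply/setP => i; rewrite !mem_zeros -scalemxAl mxE mulf_eq0 (negPf a0).
Qed.

(** Existence comes from the count of nonzero messages vanishing on [T], uniqueness from their
    proportionality. Three zeros rule out the first case of [zerosP]. *)
Lemma circles_design : is_design 3 q.+1 1 circles.
Proof.
split; first by move=> b /imsetP[w]; rewrite inE => /andP[_ /eqP Zw] ->.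
move=> T T3.
have : (0 < #|[set w : 'rV[F]_4 | (w != 0%R) && (T \subset zeros G w)]|)%N.
  by rewrite card_vanishing_nz T3 // subn_gt0 expn1; nia.
rewrite card_gt0 => /set0Pn[w]; rewrite inE => /andP[w0 Tw].
rewrite -(cards1 (zeros G w)); congr #|pred_of_set _|; apply/setP => b.
rewrite !inE; apply/andP/eqP => [[/imsetP[w' + ->] Tw']|->].
  rewrite inE => /andP[w'0 _].
  have [a wa] := vanishing3_prop T3 w0 Tw Tw'.
  by rewrite wa zeros_scale //; apply: contraNneq w'0 => a0; rewrite wa a0 scale0r.
split=> //; apply: imset_f; rewrite inE w0 /=.
by case: (zerosP w0) => [|/eqP //]; have := subset_leq_card Tw; rewrite T3; lia.
Qed.

Lemma circles_count (J : {set 'I_n}) :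
  [/\ #|J| = 0%N -> #|[set b in circles | J \subset b]| = (q * (q ^ 2 + 1))%N,
      #|J| = 1%N -> #|[set b in circles | J \subset b]| = (q * q.+1)%N,
      #|J| = 2%N -> #|[set b in circles | J \subset b]| = q.+1
    & #|J| = 3%N -> #|[set b in circles | J \subset b]| = 1%N].
Proof.
have D t := @design_count _ _ _ _ _ J circles_design (t : (#|J| <= 3)%N).
have [s qs] : exists s, q = s.+3 by exists (q - 3)%N; lia.
have b3 m : ('C(m.+2, 3) * 6 = m.+2 * m.+1 * m)%N.
  by rewrite -[6%N]/(3`!) bin_ffact !ffactnS ffactn0 muln1 /= mulnA.
have b2 m : ('C(m.+1, 2) * 2 = m.+1 * m)%N.
  by rewrite -[2%N]/(2`!) bin_ffact !ffactnS ffactn0 muln1.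
split=> J0; have := D; rewrite J0 => /(_ isT);
  rewrite muln1; move: #|[set b in circles | _]| => c.
- rewrite !subn0 nE => /(congr1 (muln^~ 6)); rewrite -mulnA.
  have -> : (q ^ 2 + 1 = (s.+2 * s.+4).+2)%N by rewrite qs; ring.
  rewrite qs !b3 => E; apply/eqP.
  have X0 : (0 < s.+4 * s.+3 * s.+2)%N by [].
  by rewrite -(eqn_pmul2r X0) E; apply/eqP; ring.
- rewrite !subn1 nE addn1 /= => /(congr1 (muln^~ 2)); rewrite -mulnA.
  have -> : (q ^ 2 = (s.+2 * s.+4).+1)%N by rewrite qs; ring.
  rewrite qs !b2 => E; apply/eqP.
  have X0 : (0 < s.+3 * s.+2)%N by [].
  by rewrite -(eqn_pmul2r X0) E; apply/eqP; ring.
- rewrite -[(3 - 2)%N]/1%N !bin1 => E; apply/eqP.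
  have X0 : (0 < s.+2)%N by [].
  rewrite -(eqn_pmul2r X0); apply/eqP.
  by move: E; rewrite qs nE qs subSS subSS subn0 => ->; lia.
- by rewrite !subnn !bin0 !muln1.
Qed.

(** Inclusion-exclusion over the three points gives [q (q^2 + 1) - 3 q (q + 1) + 3 (q + 1) - 1],
    which factors as stated. *)
Lemma circles_avoid (T : {set 'I_n}) : #|T| = 3%N ->
  #|[set b in circles | [disjoint T & b]]| = ((q ^ 2 - q - 1) * (q - 2))%N.
Proof.
move=> T3; have /set0Pn[x xT] : T != set0 by rewrite -card_gt0 T3.
have : #|T :\ x| == 2%N by move/eqP: T3; rewrite (cardsD1 x) xT add1n eqSS.
case/cards2P => y [z [yz Tx]].
have yx : y != x by have := set21 y z; rewrite -Tx !inE => /andP[].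
have zx : z != x by have := set22 y z; rewrite -Tx !inE => /andP[].
have {Tx T3 xT}-> : T = x |: (y |: (z |: set0)).
  by rewrite setU0 -[T](setD1K xT) Tx.
pose e (K J : {set 'I_n}) := #|[set b in circles | (K \subset b) && [disjoint J & b]]|.
have split_e K J u : (e K (u |: J) + e (u |: K) J = e K J)%N by apply: card_avoid_split.
have e0 K : e K set0 = #|[set b in circles | K \subset b]|.
  by apply: eq_card => b; rewrite !inE disjoints_subset sub0set andbT.
have -> : #|[set b in circles | [disjoint x |: (y |: (z |: set0)) & b]]|
    = e set0 (x |: (y |: (z |: set0))).
  by apply: eq_card => b; rewrite !inE sub0set.
have c0 : e set0 set0 = (q * (q ^ 2 + 1))%N.
  by rewrite e0; have [-> //] := circles_count set0; rewrite cards0.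
have c1 u : e (u |: set0) set0 = (q * q.+1)%N.
  by rewrite e0 setU0; have [_ -> //] := circles_count [set u]; rewrite cards1.
have c2 u v : u != v -> e (v |: (u |: set0)) set0 = q.+1.
  move=> uv; rewrite e0 setU0; have [_ _ -> //] := circles_count (v |: [set u]).
  by rewrite cards2 eq_sym uv.
have c3 : e (z |: (y |: (x |: set0))) set0 = 1%N.
  rewrite e0 setU0; have [_ _ _ -> //] := circles_count (z |: (y |: [set x])).
  by rewrite cardsU1 cards2 yx !inE negb_or zx eq_sym yz.
(* Seven splittings, one for each node of the decision tree on [x], [y], [z], give equations linear
   in the counts. *)
have := split_e set0 (y |: (z |: set0)) x.
have := split_e set0 (z |: set0) y; have := split_e (x |: set0) (z |: set0) y.
have := split_e set0 set0 z; have := split_e (x |: set0) set0 z.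
have := split_e (y |: set0) set0 z; have := split_e (y |: (x |: set0)) set0 z.
rewrite c0 !c1 !c2 ?c3 1?eq_sym // 1?eq_sym //.
have [s qs] : exists s, q = s.+3 by exists (q - 3)%N; lia.
have -> : ((q ^ 2 - q - 1) * (q - 2) = (s * s + 5 * s + 5) * s.+1)%N.
  by congr (_ * _)%N; [nia | lia].
rewrite qs; lia.
Qed.

(** Weight [q ^ 2 - q] means [q.+1] zeros, so these supports are the complements of circles, and one
    contains [T] when its circle avoids [T]. *)
Lemma min_weight_design_ovoid :
  is_design 3 (q ^ 2 - q) ((q ^ 2 - q - 1) * (q - 2))
    (weight_supports (row_code G) (q ^ 2 - q)).
Proof.
have q_sq : (q <= q ^ 2)%N by nia.
have suppE : weight_supports (row_code G) (q ^ 2 - q) = [set ~: b | b in circles].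
  apply/setP => B; apply/imsetP/imsetP => [[c]|[b /imsetP[w +  ->] ->]].
    rewrite inE => /andP[/imsetP[w _ ->] /eqP cw] ->.
    exists (zeros G w); last by rewrite /zeros setCK.
    apply: imset_f; rewrite inE; apply/andP; split.
      move: cw; apply: contra_eq_neq => ->; rewrite mul0mx wt0.
      by rewrite eq_sym -lt0n subn_gt0; nia.
    apply/eqP; have := wt_zeros w; rewrite cw; move: #|_| => Z; rewrite nE; lia.
  rewrite inE => /andP[w0 /eqP Zw]; exists (w *m G); last by rewrite /zeros setCK.
  rewrite inE mem_row_code /=; apply/eqP; have := wt_zeros w.
  by rewrite Zw; move: (wt _) => W; rewrite nE; lia.
split=> [b|T T3]; first by move=> /imsetP[c]; rewrite inE => /andP[_ /eqP <-] ->.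
rewrite -(circles_avoid T3) suppE -[RHS](card_imset _ (@setC_inj _)).
apply: eq_card => B; rewrite inE; apply/andP/imsetP.
  case=> /imsetP[b bc ->] TB; exists b => //.
  by rewrite inE bc disjoints_subset.
by case=> b; rewrite inE disjoints_subset => /andP[bc Tb] ->; rewrite imset_f.
Qed.

(** * Dual words of weight 4 *)

(** The message defining the circle is in the left kernel of the 4 by 4 submatrix at [S], so its
    columns are dependent. By [dualP] the resulting dual word has no smaller support. *)
Lemma dual_word_circle (S : {set 'I_n}) b : b \in circles -> S \subset b ->
  #|S| = 4%N -> exists2 x, x \in dual_code (row_code G) & supp x = S.
Proof.
case/imsetP => w; rewrite inE => /andP[w0 _] -> SZ S4.
have : (\rank (G *m (select F S)^T) < #|S|)%N.
  rewrite ltn_neqAle rank_leq_col andbT; apply: contra_neq w0 => r4.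
  have := SZ; rewrite zeros_kermx => /sub_kermxP wG.
  have rf : row_free (G *m (select F S)^T) by rewrite /row_free r4 S4.
  by apply: (row_free_inj rf); rewrite wG mul0mx.
case/dual_word_on => x [xD x0 xS]; exists x => //; apply/eqP.
rewrite eqEcard xS S4 ltnNge; apply: contra x0 => x3.
by rewrite (dualP xD x3).
Qed.

(** Remove a point [k] from the support and take the word vanishing on the circle through the other
    three. Orthogonality leaves only the product at [k], which must vanish, so [k] is on the
    circle. *)
Lemma dual_word_circle_conv x : x \in dual_code (row_code G) -> wt x = 4%N ->
  exists2 b, b \in circles & supp x \subset b.
Proof.
move=> xD x4; have [k kx] : exists k, k \in supp x.
  by apply/set0Pn; rewrite -card_gt0 -/(wt x) x4.
have T3 : #|supp x :\ k| = 3%N by move: x4; rewrite /wt (cardsD1 k) kx => -[].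
have [_ /(_ _ T3) c1] := circles_design.
have : (0 < #|[set b in circles | supp x :\ k \subset b]|)%N by rewrite c1.
rewrite card_gt0 => /set0Pn[b]; rewrite inE => /andP[bc Tb]; exists b => //.
rewrite -(setD1K kx) subUset Tb andbT sub1set.
case/imsetP: bc Tb => w _ -> Tw; rewrite mem_zeros.
have := xD; rewrite inE => /forallP/(_ (w *m G)).
rewrite mem_row_code /= (bigD1 k) //= big1 ?addr0.
  by rewrite mulf_eq0; move: kx; rewrite inE => /negPf ->.
move=> i ik; case xi : (i \in supp x); last first.
  by move/negbT: xi; rewrite inE negbK => /eqP ->; rewrite mul0r.
have := subsetP Tw i; rewrite 2!inE ik xi mem_zeros => /(_ isT) /eqP ->.
by rewrite mulr0.
Qed.

Lemma dual_min_distance_ovoid : min_distance (dual_code (row_code G)) 4.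
Proof.
split; last first.
  by move=> c cD; apply: contraNT; rewrite -ltnNge => /(dualP cD) ->.
have /set0Pn[b bc] : circles != set0.
  rewrite -card_gt0; have [/(_ (cards0 _)) + _ _ _] := circles_count set0.
  have -> : [set b in circles | set0 \subset b] = circles.
    by apply/setP => b; rewrite inE sub0set andbT.
  by move=> ->; nia.
(* [q_gt2] ensures that a circle has four points to choose. *)
have b4 : (4 <= #|b|)%N by have [-> //] := circles_design; lia.
have : (0 < #|[set S : {set 'I_n} | S \subset b & #|S| == 4%N]|)%N.
  by rewrite cards_draws bin_gt0.
rewrite card_gt0 => /set0Pn[S]; rewrite inE => /andP[Sb /eqP S4].
have [x xD xS] := dual_word_circle bc Sb S4; exists x => //.
rewrite /wt xS S4 eqxx andbT; apply/eqP => x0.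
by have := wt0 F n; rewrite /wt -x0 xS S4.
Qed.

(** A support through [T] lies in the unique circle through [T], hence is [T] plus one of the
    [q - 2] other points of that circle. *)
Lemma dual_min_weight_design_ovoid :
  is_design 3 4 (q - 2) (weight_supports (dual_code (row_code G)) 4).
Proof.
split=> [b|T T3]; first by move=> /imsetP[c]; rewrite inE => /andP[_ /eqP <-] ->.
have [cc /(_ _ T3)/eqP/cards1P[b bE]] := circles_design.
have : b \in [set b] by rewrite inE.
rewrite -bE inE => /andP[bc Tb].
have -> : (q - 2 = #|b :\: T|)%N by rewrite cardsDS // T3 cc //; lia.
rewrite -[RHS](card_in_imset (f := fun k => k |: T)); last first.
  move=> i j; rewrite !inE => /andP[iT _] /andP[jT _] e.
  have : i \in j |: T by rewrite -e !inE eqxx.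
  by rewrite !inE (negPf iT) orbF => /eqP.
apply: eq_card => S; rewrite inE; apply/andP/imsetP.
  case=> /imsetP[x]; rewrite inE => /andP[xD /eqP x4] -> Tx.
  have [b' b'c xb'] := dual_word_circle_conv xD x4.
  have b'b : b' = b.
    by apply/set1P; rewrite -bE inE b'c (subset_trans Tx xb').
  have : #|supp x :\: T| == 1%N by rewrite cardsDS // T3 -/(wt x) x4.
  case/cards1P => k kE; exists k.
    by rewrite -sub1set -kE setSD // -b'b.
  by rewrite -kE -{1}(setID (supp x) T) (setIidPr Tx) setUC.
case=> k; rewrite inE => /andP[kT kb] ->; split; last exact: subsetUr.
have S4 : #|k |: T| = 4%N by rewrite cardsU1 kT T3.
have Sb : k |: T \subset b by rewrite subUset sub1set kb.
have [x xD xS] := dual_word_circle bc Sb S4.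
by apply/imsetP; exists x => //; rewrite inE xD /wt xS S4 eqxx.
Qed.

End OvoidCode.

(** * Circles among the n-th roots of unity *)

Section Circles.
Set Implicit Arguments.
Unset Strict Implicit.
Variables (L : finFieldType) (q n : nat).
Hypothesis q_gt2 : (2 < q)%N.
Hypothesis nE : n = (q ^ 2 + 1)%N.
Hypothesis frobD : forall x y : L, (x + y) ^+ q = x ^+ q + y ^+ q.
Hypothesis card_Fq : #|[set s : L | s ^+ q == s]| = q.

(** The coefficients follow the order of [y ^+ (q ^ k) / y] for [k] from 0 to 3, whose exponents in
    [t = y ^+ (q - 1)] are 0, 1, [q.+1], [q] when [t] is an [n]-th root of unity. *)
Definition circle_form (a b c d t : L) := a + b * t + c * t ^+ q.+1 + d * t ^+ q.

(** The exponents 0, 1, [q], [q.+1] are distinct, so the form is a nonzero polynomial of degree at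
    most [q.+1]. *)
Lemma circle_form_roots (a b c d : L) (rs : seq L) :
  [|| a != 0, b != 0, c != 0 | d != 0] -> uniq rs ->
  all (fun t => circle_form a b c d t == 0) rs -> (size rs <= q.+1)%N.
Proof.
move=> nz u0 rs0; pose P : {poly L} := a%:P + b *: 'X + c *: 'X^(q.+1) + d *: 'X^q.
have Pc i : P`_i = a *+ (i == 0%N) + b *+ (i == 1%N) + c *+ (i == q.+1) + d *+ (i == q).
  rewrite !coefD coefC !coefZ coefX !coefXn !mulr_natr.
  by case: (i == 0%N).
have sP : (size P <= q.+2)%N.
  apply/leq_sizeP => j qj; rewrite Pc.
  have -> : (j == 0%N) = false by lia.
  have -> : (j == 1%N) = false by lia.
  have -> : (j == q.+1) = false by lia.
  have -> : (j == q) = false by lia.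
  by rewrite !addr0.
have P0 : P != 0.
  apply: contraTneq nz => P0.
  have Z i : P`_i = 0 by rewrite P0 coef0.
  have := Z 0%N; have := Z 1%N; have := Z q; have := Z q.+1; rewrite !Pc.
  have [-> -> -> ->] : [/\ (q.+1 == 0) = false, (q.+1 == 1) = false,
    (q.+1 == q.+1) = true & (q.+1 == q) = false]%N by split; lia.
  have [-> -> -> ->] : [/\ (q == 0) = false, (q == 1) = false,
    (q == q.+1) = false & (q == q) = true]%N by split; lia.
  have [-> -> -> ->] : [/\ (1 == 0) = false, (1 == 1) = true,
    (1 == q.+1) = false & (1 == q) = false]%N by split; lia.
  have [-> -> -> ->] : [/\ (0 == 0) = true, (0 == 1) = false,
    (0 == q.+1) = false & (0 == q) = false]%N by split; lia.
  rewrite !mulr0n !mulr1n !addr0 !add0r => -> -> -> ->.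
  by rewrite eqxx.
rewrite -ltnS; apply: leq_trans sP; apply: max_poly_roots => //.
apply/allP => t /(allP rs0) /eqP et; apply/eqP.
by rewrite /P !hornerE.
Qed.

Lemma frobB (x y : L) : (x - y) ^+ q = x ^+ q - y ^+ q.
Proof. by apply: (addIr (y ^+ q)); rewrite -frobD !subrK. Qed.

Lemma frob2B (x y : L) : (x - y) ^+ (q ^ 2) = x ^+ (q ^ 2) - y ^+ (q ^ 2).
Proof. by rewrite expnS expn1 !exprM !frobB. Qed.

(** The power [q ^ 2] inverts these roots of unity, as complex conjugation does on the unit
    circle. *)
Lemma unity_conj (t : L) : t ^+ n = 1 -> t != 0 /\ t ^+ (q ^ 2) = t^-1.
Proof.
rewrite nE addn1 exprSr => e; have t0 : t != 0.
  by apply: contra_eq_neq e => ->; rewrite mulr0 eq_sym oner_neq0.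
by split=> //; apply: (mulIf t0); rewrite e mulVf.
Qed.

Section ThreePoints.
Variables (t1 t2 t3 : L).
Hypotheses (u1 : t1 ^+ n = 1) (u2 : t2 ^+ n = 1) (u3 : t3 ^+ n = 1).
Hypotheses (t12 : t1 != t2) (t13 : t1 != t3) (t23 : t2 != t3).

Definition mnum (s : L) := t1 * (t2 - t3) - s * t3 * (t2 - t1).
Definition mden (s : L) := (t2 - t3) - s * (t2 - t1).
(* Sends 0, 1, infinity to t1, t2, t3. *)
Definition moebius (s : L) := mnum s / mden s.

(** Conjugation fixes [s] and inverts each [t_i]; clearing denominators exchanges numerator and
    denominator up to a common factor. *)
Lemma moebius_conj (s : L) : s ^+ q = s ->
  mden s ^+ (q ^ 2) = - mnum s / (t1 * t2 * t3) /\
  mnum s ^+ (q ^ 2) = - mden s / (t1 * t2 * t3).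
Proof.
move=> sq; have s2 : s ^+ (q ^ 2) = s by rewrite expnS expn1 exprM !sq.
have [[[n1 c1] [n2 c2]] [n3 c3]] :=
  (unity_conj u1, unity_conj u2, unity_conj u3).
rewrite /mden /mnum !(frob2B, exprMn) s2 c1 c2 c3.
by split; field; rewrite n1 n2 n3.
Qed.

Lemma mden_neq0 s : s ^+ q = s -> mden s != 0.
Proof.
move=> sq; have [e _] := moebius_conj sq.
have [[[n1 _] [n2 _]] [n3 _]] := (unity_conj u1, unity_conj u2, unity_conj u3).
apply: contraNneq t13 => d0.
have N0 : mnum s = 0.
  move/esym/eqP: e; rewrite d0 expr0n expn_eq0 -(subnK q_gt2) addnS /=.
  rewrite mulf_eq0 invr_eq0 !mulf_eq0 (negPf n1) (negPf n2) (negPf n3) !orbF.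
  by rewrite oppr_eq0 => /eqP.
(* The parameter [s] cancels in this combination, so numerator and denominator cannot both
   vanish. *)
have : (t1 - t3) * (t2 - t3) = mnum s - t3 * mden s by rewrite /mnum /mden; ring.
rewrite N0 d0 mulr0 subr0 => /eqP; rewrite mulf_eq0 !subr_eq0.
by rewrite (negPf t23) orbF.
Qed.

(** By [moebius_conj] the conjugate of [mnum s / mden s] is its inverse. *)
Lemma moebius_unity s : s ^+ q = s -> moebius s ^+ n = 1.
Proof.
move=> sq; have [e1 e2] := moebius_conj sq; have d0 := mden_neq0 sq.
have [[[n1 _] [n2 _]] [n3 _]] := (unity_conj u1, unity_conj u2, unity_conj u3).
have N0 : mnum s != 0.
  apply: contraNneq d0 => N0; move/eqP: e1.
  by rewrite N0 oppr0 mul0r expf_eq0 => /andP[].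
rewrite nE addn1 exprSr /moebius expr_div_n e1 e2.
by field; rewrite ?oppr_eq0 ?mulf_neq0 ?n1 ?n2 ?n3 ?d0 ?N0.
Qed.

(** The cross difference of two values is [s - s'] times the determinant of the Moebius map, a
    product of differences of the [t_i]. *)
Lemma moebius_inj : {in [set s : L | s ^+ q == s] &, injective moebius}.
Proof.
move=> s s'; rewrite !inE => /eqP sq /eqP s'q.
have d0 := mden_neq0 sq; have d'0 := mden_neq0 s'q.
move/eqP; rewrite /moebius eqr_div // => /eqP e; apply/eqP.
have : (s - s') * ((t2 - t3) * (t2 - t1) * (t1 - t3)) = 0.
  transitivity (mnum s * mden s' - mnum s' * mden s); last by rewrite e subrr.
  by rewrite /mnum /mden; ring.
move/eqP; rewrite !mulf_eq0 !subr_eq0 (negPf t23) (negPf t13) [t2 == t1]eq_sym.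
by rewrite (negPf t12) !orbF.
Qed.

Lemma moebius_neq3 s : s ^+ q = s -> moebius s != t3.
Proof.
move=> sq; have d0 := mden_neq0 sq; apply: contraNneq t13 => e.
have : (t1 - t3) * (t2 - t3) = mnum s - t3 * mden s by rewrite /mnum /mden; ring.
rewrite -e divfK // subrr => /eqP; rewrite mulf_eq0 e !subr_eq0.
by rewrite (negPf t23) orbF.
Qed.

(** Multiplied by [mden s * mden s ^+ q], the form becomes quadratic in [s], because [s ^+ q = s].
    Its values at 0 and 1 and its leading coefficient are multiples of the forms at [t1], [t2],
    [t3]. *)
Lemma moebius_form (a b c d s : L) : s ^+ q = s ->
  circle_form a b c d t1 = 0 -> circle_form a b c d t2 = 0 ->
  circle_form a b c d t3 = 0 -> circle_form a b c d (moebius s) = 0.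
Proof.
move=> sq f1 f2 f3; have d0 := mden_neq0 sq.
have dq0 : mden s ^+ q != 0 by rewrite expf_neq0.
have dqE : mden s ^+ q = (t2 ^+ q - t3 ^+ q) - s * (t2 ^+ q - t1 ^+ q).
  by rewrite /mden !(frobB, exprMn) sq.
have nqE : mnum s ^+ q
    = t1 ^+ q * (t2 ^+ q - t3 ^+ q) - s * t3 ^+ q * (t2 ^+ q - t1 ^+ q).
  by rewrite /mnum !(frobB, exprMn) sq.
apply: (mulfI d0); apply: (mulfI dq0); rewrite !mulr0.
transitivity ((1 - s) * (t2 - t3) * (t2 ^+ q - t3 ^+ q) * circle_form a b c d t1
  + s * (t1 - t3) * (t1 ^+ q - t3 ^+ q) * circle_form a b c d t2
  + (s ^+ 2 - s) * (t2 - t1) * (t2 ^+ q - t1 ^+ q) * circle_form a b c d t3);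
  last by rewrite f1 f2 f3 !mulr0 !addr0.
transitivity (a * mden s * mden s ^+ q + b * mnum s * mden s ^+ q
  + c * mnum s * mnum s ^+ q + d * mden s * mnum s ^+ q).
  rewrite /circle_form exprS /moebius !expr_div_n.
  move: (mden s ^+ q) (mnum s ^+ q) dq0 => Dq Nq Dq0.
  by field; rewrite ?d0 ?Dq0.
rewrite dqE nqE /circle_form !exprS /mnum /mden.
move: (t1 ^+ q) (t2 ^+ q) (t3 ^+ q) => T1 T2 T3.
by ring.
Qed.

End ThreePoints.

(** The degree bounds the zeros by [q.+1]; three zeros already produce [q.+1] of them through the
    Moebius map. *)
Lemma card_circle (t : 'I_n -> L) (a b c d : L) :
  injective t -> (forall x, x ^+ n = 1 <-> exists i, x = t i) ->
  [|| a != 0, b != 0, c != 0 | d != 0] ->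
  let Z := [set i | circle_form a b c d (t i) == 0] in
  (#|Z| <= 2)%N \/ #|Z| = q.+1.
Proof.
move=> tI tP nz Z.
case: (leqP #|Z| 2) => [|Z3]; [by left | right].
apply/eqP; rewrite eqn_leq; apply/andP; split.
  rewrite cardE -(size_map t); apply: circle_form_roots nz _ _.
    by rewrite map_inj_uniq ?enum_uniq.
  by apply/allP => x /mapP[i]; rewrite mem_enum inE => iZ ->.
case/card_gt2P: Z3 => i [j [k [[]]]]; rewrite !inE => /eqP fi /eqP fj /eqP fk [ij jk ki].
have tu l : t l ^+ n = 1 by apply/tP; exists l.
have tij : t i != t j by rewrite (inj_eq tI).
have tjk : t j != t k by rewrite (inj_eq tI).
have tik : t i != t k by rewrite (inj_eq tI) eq_sym.
(* The image of the projective line over the fixed field of [q]-th powers, with [t k] as the image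
   of infinity. *)
pose S := t k |: [set moebius (t i) (t j) (t k) s | s in [set s : L | s ^+ q == s]].
have cS : #|S| = q.+1.
  rewrite cardsU1 card_in_imset ?card_Fq; last exact: moebius_inj.
  rewrite (_ : t k \notin _) //; apply/imsetP => -[s]; rewrite inE => /eqP sq /esym/eqP.
  by apply/negP; apply: moebius_neq3.
rewrite -cS -(card_imset _ tI); apply/subset_leq_card/subsetP => x.
rewrite !inE => /orP[/eqP ->|/imsetP[s]]; first by apply: imset_f; rewrite inE fk.
rewrite inE => /eqP sq xE.
have /tP[l xl] : x ^+ n = 1 by rewrite xE; apply: moebius_unity.
rewrite xl; apply: imset_f; rewrite inE -xl xE; apply/eqP.
exact: moebius_form.
Qed.

End Circles.

(** * Fixed points of Frobenius and independence of columns *)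

(** ['X^q - 'X] divides ['X^(q ^ k) - 'X], which is the product of the ['X - x] over all [x] in [L],
    so it has [q] distinct roots there. *)
Lemma card_frob_fixed (L : finFieldType) (q k : nat) : (1 < q)%N -> (0 < k)%N ->
  #|L| = (q ^ k)%N -> #|[set s : L | s ^+ q == s]| = q.
Proof.
move=> q1 k0 cardL; pose D : {poly L} := 'X^q - 'X.
have sD : size D = q.+1 by rewrite size_polyDl ?size_polyXn ?size_polyN ?size_polyX.
have D0 : D != 0 by rewrite -size_poly_eq0 sD.
have rootD s : root D s = (s ^+ q == s) by rewrite /root !hornerE subr_eq0.
have dvdD j : (0 < j)%N -> D %| 'X^(q ^ j) - 'X.
  case: j => // j _; elim: j => [|j IHj]; first by rewrite expn1.
  have -> : 'X^(q ^ j.+2) - 'X = ('X^(q ^ j.+1) ^+ q - 'X ^+ q) + D :> {poly L}.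
    by rewrite -exprM -expnSr /D addrA subrK.
  by rewrite dvdp_add // subrXX dvdp_mulr.
have := dvdD k k0; rewrite -cardL finField_genPoly.
case/dvdp_prod_XsubC => m Dm.
have um : uniq (mask m (index_enum L)) by rewrite mask_uniq // index_enum_uniq.
have := eqp_size Dm; rewrite sD size_prod_XsubC => -[sm].
apply/eqP; rewrite eqn_leq; apply/andP; split.
  rewrite cardE -ltnS -sD; apply: max_poly_roots; rewrite ?enum_uniq //.
  by apply/allP => s; rewrite mem_enum inE rootD.
rewrite [X in (X <= _)%N]sm -(card_uniqP um); apply/subset_leq_card/subsetP => s sm'.
by rewrite inE -rootD (eqp_root Dm) root_prod_XsubC.
Qed.

(** The four sums make [z] orthogonal to every circle form; a form that vanishes at all but one
    point of the support gives the contradiction. *)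
Lemma circle_points_independent (L : finFieldType) (q n : nat)
    (t z : 'I_n -> L) : (0 < q)%N -> (1 < n)%N ->
  (forall x y : L, (x + y) ^+ q = x ^+ q + y ^+ q) -> injective t ->
  \sum_i z i = 0 -> \sum_i z i * t i = 0 ->
  \sum_i z i * t i ^+ q.+1 = 0 -> \sum_i z i * t i ^+ q = 0 ->
  (#|[set i | z i != 0%R]| <= 3)%N -> forall i, z i = 0.
Proof.
move=> q0 n1 frobD tI s0 s1 s2 s3 z3 k; apply/eqP; apply: contraT => zk.
set A := [set i | z i != 0] in z3.
have kA : k \in A by rewrite inE.
(* A spare index, used as padding when the support has fewer than three positions. *)
have [k' k'k] : exists k', k' != k.
  have : (0 < #|[set~ k]|)%N by rewrite cardsC1 card_ord; case: (n) n1 => [|[]].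
  by rewrite card_gt0 => /set0Pn[k']; rewrite !inE; exists k'.
have [a [b [ak bk Aab]]] : exists a b, [/\ a != k, b != k & A :\ k \subset [set a; b]].
  have : (size (enum (A :\ k)) <= 2)%N.
    by rewrite -cardE; move: z3; rewrite (cardsD1 k) kA.
  have inA i : (i \in enum (A :\ k)) = (i \in A :\ k) by rewrite mem_enum.
  case eA : (enum (A :\ k)) => [|a [|b [|//]]] _.
  - exists k', k'; split=> //; apply/subsetP => i; rewrite -inA eA //.
  - have : a \in A :\ k by rewrite -inA eA mem_head.
    rewrite !inE => /andP[ak _]; exists a, k'; split=> //; apply/subsetP => i.
    by rewrite -inA eA !inE => ->.
  - have : a \in A :\ k by rewrite -inA eA mem_head.
    rewrite !inE => /andP[ak _].
    have : b \in A :\ k by rewrite -inA eA !inE eqxx orbT.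
    rewrite !inE => /andP[bk _]; exists a, b; split=> //; apply/subsetP => i.
    by rewrite -inA eA !inE.
(* The form (X - t a)(X^q - t b^q) isolates the term of index k. *)
have : \sum_i z i * ((t i - t a) * (t i ^+ q - t b ^+ q)) = 0.
  transitivity (\sum_i (z i * t i ^+ q.+1) - t b ^+ q * (\sum_i z i * t i)
    - t a * (\sum_i z i * t i ^+ q) + t a * t b ^+ q * \sum_i z i).
    rewrite !mulr_sumr -!sumrB -big_split /=; apply: eq_bigr => i _.
    by rewrite exprS; ring.
  by rewrite s0 s1 s2 s3 !mulr0 !subr0 addr0.
rewrite (bigD1 k) //= big1 ?addr0 => [|i ik].
  move/eqP; rewrite !mulf_eq0 (negPf zk) subr_eq0 (inj_eq tI) eq_sym (negPf ak) /=.
  have <- : (t k - t b) ^+ q = t k ^+ q - t b ^+ q.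
    by apply: (addIr (t b ^+ q)); rewrite -frobD !subrK.
  by rewrite expf_eq0 q0 subr_eq0 (inj_eq tI) eq_sym (negPf bk).
have [->|zi] := eqVneq (z i) 0; first by rewrite mul0r.
have : i \in [set a; b] by apply: (subsetP Aab); rewrite !inE ik.
by rewrite !inE => /orP[/eqP->|/eqP->]; rewrite subrr ?mul0r ?mulr0.
Qed.

(** The exponents of [y ^+ (q - 1)] are [(q^k - 1) / (q - 1)]; for [k = 3] this is [q^2 + q + 1],
    which reduces to [q] modulo [q^2 + 1]. *)
Lemma conjugate_powers (R : nzRingType) (q : nat) (y : R) : (0 < q)%N ->
  y ^+ (q - 1) ^+ (q ^ 2 + 1) = 1 ->
  [/\ y ^+ q = y * y ^+ (q - 1),
      y ^+ (q ^ 2) = y * y ^+ (q - 1) ^+ q.+1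
    & y ^+ (q ^ 3) = y * y ^+ (q - 1) ^+ q].
Proof.
move=> q0; have [s ->] : exists s, q = s.+1 by exists q.-1; rewrite prednK.
rewrite subn1 /= -!exprM -!exprS => t1; split=> //.
  by congr (_ ^+ _); ring.
have -> : (s.+1 ^ 3 = (s * s.+1).+1 + s * (s.+1 ^ 2 + 1))%N by ring.
by rewrite exprD t1 mulr1.
Qed.

(** * Constacyclic codes *)

Section CodeWords.
Set Implicit Arguments.
Unset Strict Implicit.

(** Write [c = w * g] and interpolate [w] at the roots of [h]. Each term is then a multiple of
    [('X^n - l) / ('X - rho k)], a geometric sum. *)
Lemma check_roots_expansion (L : fieldType) (n d : nat) (l : L) (rho : 'I_d -> L)
    (c : {poly L}) :
  (0 < n)%N -> injective rho -> (forall k, rho k ^+ n = l) -> (size c <= n)%N ->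
  ('X^n - l%:P) %/ (\prod_k ('X - (rho k)%:P)) %| c ->
  exists u : 'I_d -> L, forall i, (i < n)%N ->
    c`_i = \sum_k u k * rho k ^+ (n.-1 - i).
Proof.
move=> n0 rI rl cn; set h := \prod_k _; set P := 'X^n - _; set g := P %/ h => gc.
have sP : size P = n.+1 by rewrite size_XnsubC.
have P0 : P != 0 by rewrite -size_poly_eq0 sP.
have sh : size h = d.+1 by rewrite size_prod_XsubC /index_enum -enumT size_enum_ord.
have hP : P = g * h.
  rewrite divpK // /h.
  have -> : \prod_k ('X - (rho k)%:P) = \prod_(z <- map rho (enum 'I_d)) ('X - z%:P).
    by rewrite big_map big_enum.
  apply: uniq_roots_dvdp; last by rewrite uniq_rootsE map_inj_uniq ?enum_uniq.
  by apply/allP => _ /mapP[k _ ->]; rewrite /root !hornerE rl subrr.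
have /andP[g0 h0] : (g != 0) && (h != 0) by rewrite -negb_or -mulf_eq0 -hP.
pose w := c %/ g; have cE : c = w * g by rewrite divpK.
have sw : (size w <= d)%N.
  have [->|w0] := eqVneq w 0; first by rewrite size_poly0.
  have g1 : (0 < size g)%N by rewrite size_poly_gt0.
  have := cn; have := sP; rewrite hP cE !size_mul // sh.
  by move: (size w) (size g) g1 => a b b0 e1 e2; lia.
pose hk k := \prod_(j | j != k) ('X - (rho j)%:P).
have hE k : h = ('X - (rho k)%:P) * hk k by rewrite /h (bigD1 k).
have hk_eq0 j k : j != k -> (hk k).[rho j] = 0.
  by move=> jk; rewrite /hk (bigD1 j) //= hornerM !hornerE subrr mul0r.
have hk_neq0 k : (hk k).[rho k] != 0.
  rewrite /hk horner_prod; apply/prodf_neq0 => j jk.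
  by rewrite !hornerE subr_eq0 (inj_eq rI) eq_sym.
pose u k := w.[rho k] / (hk k).[rho k].
(* Lagrange interpolation: both sides have size at most [d] and agree at the [d] roots. *)
have wE : w = \sum_k u k *: hk k.
  apply/eqP; rewrite -subr_eq0; apply/eqP.
  apply: (@roots_geq_poly_eq0 _ _ (map rho (enum 'I_d))).
  - apply/allP => _ /mapP[k _ ->]; rewrite /root hornerD hornerN horner_sum (bigD1 k) //=.
    rewrite hornerZ /u divfK // big1 ?addr0 ?subrr // => j jk.
    by rewrite hornerZ (hk_eq0 k j) ?mulr0 // eq_sym.
  - by rewrite map_inj_uniq ?enum_uniq.
  rewrite size_map size_enum_ord; apply: leq_trans (size_polyD _ _) _.
  rewrite geq_max sw size_polyN; apply: leq_trans (size_sum _ _ _) _.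
  apply/bigmax_leqP => k _; apply: leq_trans (size_scale_leq _ _) _.
  have : hk k != 0 by apply: contraNneq (hk_neq0 k) => ->; rewrite horner0.
  move: sh; rewrite (hE k) => + hk0.
  by rewrite size_mul ?polyXsubC_eq0 // size_XsubC /= => -[<-].
exists u => i ilt.
have ghk k : g * hk k = \poly_(i < n) rho k ^+ (n.-1 - i).
  apply: (mulfI (negbT (polyXsubC_eq0 (rho k)))).
  rewrite mulrCA -hE -hP /P -(rl k) rmorphXn subrXX; congr (_ * _).
  rewrite poly_def (reindex_inj rev_ord_inj); apply: eq_bigr => j _.
  have e : (n - j.+1 = n.-1 - j)%N by rewrite -subn1 -subnDA add1n.
  rewrite /= e subKn; last by rewrite -ltnS prednK.
  by rewrite -polyC_exp mulrC mul_polyC.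
rewrite cE wE mulr_suml coef_sum; apply: eq_bigr => k _.
by rewrite -scalerAl coefZ [hk k * g]mulrC ghk coef_poly ilt.
Qed.

End CodeWords.

(** The rows are the shifts ['X^i * g] with [i < k], which fit in length [n], so encoding is
    multiplication of polynomials by [g]. *)
Lemma generator_matrix (F : finFieldType) (k n : nat) (g : {poly F}) :
  g != 0 -> ((size g).-1 + k = n)%N ->
  exists2 G : 'M[F]_(k, n), row_free G &
    forall c, (c \in row_code G) = (g %| rVpoly c).
Proof.
move=> g0 sg; pose G : 'M[F]_(k, n) := \matrix_(i < k) poly_rV ('X^i * g).
have g1 : (0 < size g)%N by rewrite size_poly_gt0.
have GE w : rVpoly (w *m G) = rVpoly w * g.
  rewrite mulmx_sum_row linear_sum /= [rVpoly w]poly_def mulr_suml.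
  apply: eq_bigr => i _; rewrite linearZ /= rowK poly_rV_K.
    by rewrite -scalerAl valK.
  rewrite size_monicM ?monicXn // size_polyXn -sg.
  by have := ltn_ord i; move: (size g) g1 => a; lia.
exists G.
  rewrite -kermx_eq0; apply: contraT.
  case/rowV0Pn => w /sub_kermxP wG /negP[]; apply/eqP.
  have := GE w; rewrite wG linear0 => /esym/eqP.
  by rewrite mulf_eq0 (negPf g0) orbF => /eqP w0; rewrite -[w]rVpolyK w0 linear0.
move=> c; apply/imsetP/idP => [[w _ ->]|/dvdpP[v cv]].
  by rewrite GE dvdp_mull.
have vk : (size v <= k)%N.
  have [->|v0] := eqVneq v 0; first by rewrite size_poly0.
  have : (size (rVpoly c) <= n)%N by apply: size_poly.
  rewrite cv size_mul // -sg.
  by move: (size v) (size g) g1 => a b; lia.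
exists (poly_rV v) => //.
by apply: (can_inj rVpolyK); rewrite GE poly_rV_K.
Qed.

(** * Descent to [F] and the arithmetic of the order of [lam] *)

(** The image of [sigma] consists of [#|F|] fixed points, and there are no more than that. *)
Lemma frobenius_fixed_image (F L : finFieldType) (sigma : {rmorphism F -> L})
    (x : L) : #|L| = (#|F| ^ 2)%N -> x ^+ #|F| = x -> exists a, x = sigma a.
Proof.
move=> cL xF; have F1 := finNzRing_gt1 F.
have cfix := card_frob_fixed F1 (isT : (0 < 2)%N) cL.
have sub : [set sigma a | a in F] \subset [set s : L | s ^+ #|F| == s].
  by apply/subsetP => _ /imsetP[a _ ->]; rewrite inE -rmorphXn expf_card.
have : x \in [set sigma a | a in F].
  suff -> : [set sigma a | a in F] = [set s : L | s ^+ #|F| == s] by rewrite inE xF.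
  by apply/eqP; rewrite eqEcard sub cfix card_imset ?leqnn //; apply: fmorph_inj.
by case/imsetP => a _ ->; exists a.
Qed.

(** The sum and product of the two conjugates are fixed by Frobenius. *)
Lemma conjugate_pair_descent (F L : finFieldType) (sigma : {rmorphism F -> L})
    (x : L) : #|L| = (#|F| ^ 2)%N ->
  (forall y z : L, (y + z) ^+ #|F| = y ^+ #|F| + z ^+ #|F|) ->
  exists p : {poly F},
    map_poly sigma p = ('X - x%:P) * ('X - (x ^+ #|F|)%:P).
Proof.
move=> cL frobD.
have xFF : x ^+ #|F| ^+ #|F| = x by rewrite -exprM -[(_ * _)%N]/(#|F| ^ 2)%N -cL expf_card.
have [a aE] : exists a, x + x ^+ #|F| = sigma a.
  by apply: frobenius_fixed_image => //; rewrite frobD xFF addrC.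
have [b bE] : exists b, x * x ^+ #|F| = sigma b.
  by apply: frobenius_fixed_image => //; rewrite exprMn xFF mulrC.
exists ('X^2 - a *: 'X + b%:P).
rewrite rmorphD rmorphB /= map_polyXn map_polyZ map_polyX map_polyC /= -aE -bE.
by rewrite -mul_polyC rmorphD rmorphM /=; ring.
Qed.

(** Equal valuations make [w] odd, while a common divisor of [q - 1] and
    [q^2 + 1 = (q - 1)(q + 1) + 2] divides 2. *)
Lemma coprime_cofactor_sq_succ (q r w : nat) : (1 < q)%N -> (q - 1 = r * w)%N ->
  logn 2 r = logn 2 (q - 1) -> coprime w (q ^ 2 + 1).
Proof.
move=> q1 qrw l2; have [r0 w0] : (0 < r)%N /\ (0 < w)%N.
  by apply/andP; rewrite -muln_gt0 -qrw subn_gt0.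
have ow : ~~ (2 %| w)%N.
  rewrite -(expn1 2) pfactor_dvdn // -leqNgt leqn0.
  by have := l2; rewrite qrw lognM // => /eqP; rewrite -{1}[logn 2 r]addn0 eqn_add2l eq_sym.
rewrite /coprime; set d := gcdn _ _.
have dw : (d %| w)%N by apply: dvdn_gcdl.
have d2 : (d %| 2)%N.
  have := dvdn_gcdr w (q ^ 2 + 1); rewrite -/d.
  have -> : (q ^ 2 + 1 = r * w * q.+1 + 2)%N by rewrite -qrw; nia.
  by rewrite dvdn_addr // dvdn_mulr // dvdn_mull.
by move: d2 dw; case: d => [|[|[|d]]] // _ /(negP ow).
Qed.

Theorem theorem3p4 (p m q n r : nat) (F L : finFieldType)
  (sigma : {rmorphism F -> L}) (lam : F) (delta : L) :
  prime p -> (0 < m)%N -> q = (p ^ m)%N -> (2 < q)%N -> n = (q ^ 2 + 1)%N ->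
  #|F| = (q ^ 2)%N -> #|L| = (q ^ 4)%N ->
  lam != 0 -> r.-primitive_root lam -> (r %| q - 1)%N ->
  logn 2 r = logn 2 (q - 1) ->
  (r * n).-primitive_root delta -> delta ^+ n = sigma lam ->
  let g1 := ('X - delta%:P) * ('X - (delta ^+ (q ^ 2))%:P) in
  let g2 := ('X - (delta ^+ (q ^ 2 - q + 1))%:P) *
            ('X - (delta ^+ (q ^ 4 - q ^ 3 + q ^ 2))%:P) in
  let C := constacyclic_code sigma n lam (g1 * g2) in
  let D := dual_code C in
  [/\ code_dim C = 4%N,
      min_distance C (q ^ 2 - q),
      (forall i : nat, weight_count C i =
         if i == 0%N then 1%N
         else if i == (q ^ 2 - q)%N then (q ^ 5 - q)%N
         else if (i == (q ^ 2 - 1)%N) || (i == (q ^ 2 + 1)%N)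
           then ((q ^ 4 - 1) * (q - 1) * q ^ 3 %/ 2)%N
         else if i == (q ^ 2)%N then (q ^ 7 - q ^ 5 + q ^ 4 - q ^ 3 + q - 1)%N
         else 0%N)
    & is_design 3 (q ^ 2 - q) ((q ^ 2 - q - 1) * (q - 2)) (weight_supports C (q ^ 2 - q))]
  /\ [/\ code_dim D = (q ^ 2 - 3)%N,
      min_distance D 4
    & is_design 3 4 (q - 2) (weight_supports D 4)].
Proof.
move=> p_pr m0 qE q_gt2 nE cF cL lam0 lam_r r_dvd l2 delta_prim delta_n g1 g2 C D.
have q0 : (0 < q)%N by lia.
have n_gt : (q.+1 < n)%N by rewrite nE; nia.
have cL2 : #|L| = (#|F| ^ 2)%N by rewrite cL cF -expnM.
have pL : p \in [pchar L].
  by apply: (@card_finPcharP _ _ (m * 4)); rewrite // cL qE -expnM.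
have frob k (x y : L) : (x + y) ^+ (q ^ k) = x ^+ (q ^ k) + y ^+ (q ^ k).
  apply: exprDn_pchar; rewrite qE -expnM pnatX pnatE // pL.
  by [].
have frobD (x y : L) : (x + y) ^+ q = x ^+ q + y ^+ q by have := frob 1%N x y; rewrite expn1.
case/dvdnP: r_dvd => w; rewrite mulnC => qrw.
pose tau := delta ^+ (q - 1).
(* The order of [tau] is [r * n] divided by its gcd with [q - 1 = r * w]; that gcd is [r] since [w]
   and [n] are coprime. *)
have tau_prim : n.-primitive_root tau.
  have := exp_prim_root delta_prim (q - 1); rewrite -/tau qrw.
  have r0 : (0 < r)%N by apply: prim_order_gt0 lam_r.
  have cop : coprime w n.
    by rewrite nE; apply: (coprime_cofactor_sq_succ _ qrw l2); lia.
  by rewrite -muln_gcdr (eqP cop) muln1 mulKn.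
have tau_n : tau ^+ (q ^ 2 + 1) = 1 by rewrite -nE prim_expr_order.
have tau_inj a b : (a < n)%N -> (b < n)%N -> tau ^+ a = tau ^+ b -> a = b.
  move=> an bn /eqP; rewrite (eq_prim_root_expr tau_prim) !modn_small //.
  by move=> /eqP.
pose rho (k : 'I_4) := delta ^+ (q ^ k).
have [d1 d2 d3] := conjugate_powers q0 tau_n; rewrite -/tau in d1 d2 d3.
have delta0 : delta != 0.
  apply: contra_neq lam0 => d0; apply: (fmorph_inj sigma).
  by rewrite rmorph0 -delta_n d0 expr0n nE addn1.
have rhoI : injective rho.
  (* The exponents of [tau] in [rho k / delta]; they are distinct and below the order [n] of
     [tau]. *)
  pose e := [:: 0; 1; q.+1; q]%N.
  have rhoE k : rho k = delta * tau ^+ nth 0%N e k.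
    by case: k => -[|[|[|[|//]]]] ? /=; rewrite /rho /= ?expr1 ?expr0 ?mulr1.
  move=> j k; rewrite !rhoE => /(mulfI delta0) /tau_inj ejk.
  have en (i : 'I_4) : (nth 0 e i < n)%N.
    by case: i => -[|[|[|[|//]]]] ? /=; lia.
  have ue : uniq e by rewrite /= !inE; lia.
  by apply/val_inj/eqP; rewrite -(nth_uniq 0%N _ _ ue) ?ltn_ord // ejk.
have rho_n k : rho k ^+ n = sigma lam.
  rewrite /rho exprAC delta_n -rmorphXn; congr (sigma _).
  have lq : lam ^+ q = lam.
    have -> : q = (r * w).+1 by lia.
    by rewrite exprS exprM (prim_expr_order lam_r) expr1n mulr1.
  by elim: (val k) => [|i IH]; rewrite ?expr1 // expnS exprM lq.
have subE a b c : a = (b + c)%N -> (a - c = b)%N by move=> ->; rewrite addnK.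
have [s qs] : exists s, q = s.+1 by exists q.-1; rewrite prednK.
(* Modulo [(q - 1)(q^2 + 1)], an exponent that kills [delta], the roots of [g2] become
   [delta ^+ (q ^ 3)] and [delta ^+ q]. Together with those of [g1] they are the four [rho k]. *)
have e3 : (q ^ 3 = (q ^ 2 - q + 1) + (q - 1) * (q ^ 2 + 1))%N.
  rewrite qs subn1 (subE (s.+1 ^ 2)%N (s * s.+1)%N s.+1); last by ring.
  by rewrite /=; ring.
have e1 : (q ^ 4 - q ^ 3 + q ^ 2 = q + (q - 1) * (q ^ 2 + 1) * q)%N.
  rewrite qs subn1 (subE (s.+1 ^ 4)%N (s * s.+1 ^ 3)%N); last by ring.
  by rewrite /=; ring.
have e2 : ((q ^ 2 - q + 1) * q ^ 2 = q ^ 4 - q ^ 3 + q ^ 2)%N.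
  rewrite qs (subE (s.+1 ^ 4)%N (s * s.+1 ^ 3)%N); last by ring.
  by rewrite (subE (s.+1 ^ 2)%N (s * s.+1)%N s.+1); ring.
have hE : g1 * g2 = \prod_k ('X - (rho k)%:P).
  rewrite 4!big_ord_recl big_ord0 mulr1 /rho /= expn0 expr1 expn1 /g1 /g2.
  have -> : delta ^+ (q ^ 3) = delta ^+ (q ^ 2 - q + 1).
    by rewrite e3 exprD exprM tau_n mulr1.
  have -> : delta ^+ (q ^ 4 - q ^ 3 + q ^ 2) = delta ^+ q.
    by rewrite e1 exprD 2!exprM tau_n expr1n mulr1.
  by ring.
have frobF (x y : L) : (x + y) ^+ #|F| = x ^+ #|F| + y ^+ #|F| by rewrite cF frob.
have [h1 h1E] := conjugate_pair_descent sigma delta cL2 frobF.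
have [h2 h2E] := conjugate_pair_descent sigma (delta ^+ (q ^ 2 - q + 1)) cL2 frobF.
have hF : map_poly sigma (h1 * h2) = g1 * g2.
  by rewrite rmorphM /= h1E h2E cF -exprM e2.
pose g := ('X^n - lam%:P) %/ (h1 * h2).
have sh : size (h1 * h2) = 5%N.
  by rewrite -(size_map_poly sigma) hF hE size_prod_XsubC /index_enum -enumT size_enum_ord.
have sg : size g = (n - 3)%N.
  by rewrite size_divp -?size_poly_eq0 sh // size_XnsubC //; lia.
(* Division and divisibility commute with [sigma], so membership can be tested over [F]. *)
have memC c : (c \in C) = (g %| rVpoly c).
  rewrite inE -(dvdp_map sigma) map_divp hF; congr (_ %/ _ %| _).
  by rewrite rmorphB /= map_polyXn map_polyC.
have [||G Gfree GE] := @generator_matrix F 4 n g.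
- by rewrite -size_poly_eq0 sg; lia.
- by rewrite sg; lia.
have CE : C = row_code G by apply/setP => c; rewrite memC GE.
pose Y : 'M[L]_(4, n) := \matrix_(k, j) rho k ^+ (n.-1 - j).
have rowsE (i : 'I_4) : exists u : 'I_4 -> L,
    forall j, sigma (G i j) = \sum_k u k * rho k ^+ (n.-1 - j).
  have Gi : row i G \in C by rewrite CE rowE mem_row_code.
  have n0 : (0 < n)%N by apply: leq_trans n_gt.
  have [||u uE] := check_roots_expansion
    (c := map_poly sigma (rVpoly (row i G))) n0 rhoI rho_n.
  - by rewrite size_map_poly size_poly.
  - by move: Gi; rewrite inE hE.
  exists u => j; rewrite -(uE j (ltn_ord j)) coef_map coef_rVpoly_ord.
  by rewrite mxE.
have [u uE] := fin_all_exists rowsE.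
pose U : 'M[L]_4 := \matrix_(i, k) u i k.
have UY : map_mx sigma G = U *m Y.
  by apply/matrixP => i j; rewrite !mxE uE; apply: eq_bigr => k _; rewrite !mxE.
(* The rank 4 of [G] survives extension of scalars and bounds the rank of [U] from below. *)
have Ufree : row_free U.
  rewrite /row_free eqn_leq rank_leq_row -{1}(eqP Gfree) -(mxrank_map sigma) UY.
  exact: mxrankM_maxl.
pose y (j : 'I_n) := delta ^+ (n.-1 - j).
pose t (j : 'I_n) := tau ^+ (n.-1 - j).
have yt j : y j ^+ (q - 1) = t j by rewrite /y /t exprAC.
have tn j : t j ^+ (q ^ 2 + 1) = 1 by rewrite /t exprAC tau_n expr1n.
have y0 j : y j != 0 by rewrite expf_neq0.
have YE j : [/\ Y 0 j = y j, Y 1 j = y j * t j, Y 2 j = y j * t j ^+ q.+1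
    & Y 3 j = y j * t j ^+ q].
  have := @conjugate_powers _ q (y j) q0; rewrite yt => /(_ (tn j)) [<- <- <-].
  rewrite !mxE /rho /=; split; rewrite [LHS]exprAC //.
have tI : injective t.
  move=> i j /tau_inj e; apply: val_inj => /=.
  by have := ltn_ord i; have := ltn_ord j; clear -e; lia.
have tP x : x ^+ n = 1 <-> exists i, x = t i.
  split=> [/(prim_rootP tau_prim)[i ->]|[i ->]]; last by rewrite nE tn.
  (* Positions are reversed because the exponent in [t] is [n.-1 - j]. *)
  exists (rev_ord i); rewrite /t /=; congr (_ ^+ _).
  by have := ltn_ord i; clear; lia.
have sum4 (f : 'I_4 -> L) : \sum_k f k = f 0 + f 1 + f 2 + f 3.
  rewrite 4!big_ord_recl big_ord0 addr0 !addrA.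
  by congr (f _ + f _ + f _ + f _); apply: val_inj.
have zerosP (v : 'rV_4) : v != 0 ->
    (#|zeros G v| <= 2)%N \/ #|zeros G v| = q.+1.
  move=> v0; pose c := map_mx sigma v *m U.
  have c0 : c != 0.
    apply: contra_neq v0 => c0; apply/(map_mx_inj (f := sigma))/(row_free_inj Ufree).
    by rewrite /= map_mx0 mul0mx.
  have sigmaE j : sigma ((v *m G) 0 j)
      = y j * circle_form q (c 0 0) (c 0 1) (c 0 2) (c 0 3) (t j).
    transitivity ((c *m Y) 0 j); first by rewrite /c -mulmxA -UY -map_mxM [in RHS]mxE.
    rewrite mxE sum4; have [-> -> -> ->] := YE j.
    by rewrite /circle_form; ring.
  have -> : zeros G v =
      [set j | circle_form q (c 0 0) (c 0 1) (c 0 2) (c 0 3) (t j) == 0].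
    apply/setP => j; rewrite mem_zeros inE -(fmorph_eq0 sigma) sigmaE mulf_eq0.
    by rewrite (negPf (y0 j)).
  have card_Fq : #|[set x : L | x ^+ q == x]| = q.
    by apply: (card_frob_fixed _ (isT : (0 < 4)%N) cL); apply: ltnW.
  apply: card_circle => //.
  apply: contraNT c0; rewrite !negb_or !negbK => /and4P[/eqP c00 /eqP c01 /eqP c02 /eqP c03].
  apply/eqP/rowP => k; rewrite [RHS]mxE.
  by case: k => -[|[|[|[|//]]]] k4; [rewrite -c00|rewrite -c01|rewrite -c02|rewrite -c03];
    congr (c _ _); apply: val_inj.
have dualP (x : 'rV_n) : x \in dual_code (row_code G) -> (wt x <= 3)%N -> x = 0.
  rewrite mem_dual_row_code => /eqP xG x3.
  (* Since [G] becomes [U *m Y] over [L], the invertible factor [U^T] can be cancelled. *)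
  have xY : map_mx sigma x *m Y^T = 0.
    have UTfree : row_free U^T by rewrite /row_free mxrank_tr.
    apply: (row_free_inj UTfree).
    by rewrite /= mul0mx -mulmxA -trmx_mul -UY map_trmx -map_mxM xG map_mx0.
  (* Absorbing the nonzero factor [y j] keeps the support and leaves pure powers of [t j] in the
     four sums. *)
  pose z j := sigma (x 0 j) * y j.
  have S k : \sum_j sigma (x 0 j) * Y k j = 0.
    transitivity ((map_mx sigma x *m Y^T) 0 k); last by rewrite xY mxE.
    by rewrite [RHS]mxE; apply: eq_bigr => j _; rewrite !mxE.
  have zE j : (z j == 0) = (x 0 j == 0).
    by rewrite mulf_eq0 fmorph_eq0 (negPf (y0 j)) orbF.
  have z0 : forall j, z j = 0.
    have n1 : (1 < n)%N by apply: leq_trans n_gt.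
    apply: (circle_points_independent q0 n1 frobD tI).
    - by rewrite -[RHS](S 0); apply: eq_bigr => j _; have [-> _ _ _] := YE j.
    - by rewrite -[RHS](S 1); apply: eq_bigr => j _; have [_ -> _ _] := YE j; rewrite mulrA.
    - by rewrite -[RHS](S 2); apply: eq_bigr => j _; have [_ _ -> _] := YE j; rewrite mulrA.
    - by rewrite -[RHS](S 3); apply: eq_bigr => j _; have [_ _ _ ->] := YE j; rewrite mulrA.
    apply: leq_trans x3; apply/eq_leq/eq_card => j.
    by rewrite !inE zE.
  by apply/rowP => j; apply/eqP; rewrite mxE -zE z0.
rewrite /D CE; split; split.
- exact/code_dim_row_code.
- exact: (min_distance_ovoid q_gt2 nE cF zerosP dualP).
- exact: (weight_count_ovoid q_gt2 nE cF zerosP dualP).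
- exact: (min_weight_design_ovoid q_gt2 nE cF zerosP dualP).
- by rewrite code_dim_dual_row_code //; clear -nE q_gt2; lia.
- exact: (dual_min_distance_ovoid q_gt2 nE cF zerosP dualP).
- exact: (dual_min_weight_design_ovoid q_gt2 nE cF zerosP dualP).
Qed.
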